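(* Let $S$ be a finite semigroup with kernel $K_S$. Then $S$ is s-indecomposable if and only if the algebra $\mathbb{C}[S/K_S]/J(\mathbb{C}[S/K_S])$ has exactly one $1$-dimensional ideal.
   Context: Semigroups are nonempty. A semilattice is a commutative semigroup all of whose elements are idempotent. A semigroup $S$ is semilattice indecomposable (s-indecomposable) if every semilattice homomorphic image of $S$ is trivial, i.e. has exactly one element. The kernel $K_S$ of a finite semigroup $S$ is its (unique) minimal two-sided ideal. For an ideal $I$ of $S$, $S/I$ is the Rees factor semigroup, obtained by collapsing $I$ to a single element, which is a zero of $S/I$. For a semigroup $T$, $\mathbb{C}[T]$ denotes the (non-contracted) semigroup algebra of $T$ over the complex numbers, i.e. the vector space with basis $T$ and multiplication extending that of $T$ bilinearly (it need not be unital). For a finite-dimensional associative $\mathbb{C}$-algebra $A$, $J(A)$ denotes its Jacobson radical (the set of properly nilpotent elements; equivalently the largest nilpotent two-sided ideal). A $1$-dimensional ideal is a two-sided ideal whose dimension over $\mathbb{C}$ is $1$. *)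

(* Defs.v *)
From HB Require Import structures.
From mathcomp Require Import all_boot all_order all_algebra.
From mathcomp Require Import boolp reals.
From mathcomp Require Import complex.

Set Implicit Arguments.
Unset Strict Implicit.
Unset Printing Implicit Defensive.

Import GRing.Theory.
Local Open Scope ring_scope.

HB.mixin Record Finite_isNonempty T of Finite T := {
  card_gt0_subproof : (0 < #|{: T}|)%N
}.

#[short(type="finSemigroupType")]
HB.structure Definition FinSemigroup :=
  {S of Semigroup S & Finite S & Finite_isNonempty S}.

Definition is_semilattice (T : semigroupType) : Prop :=
  (forall x y : T, (x * y = y * x)%g) /\ (forall x : T, (x * x = x)%g).

(* Any image of a finite semigroup has decidable equality and choice, so letting
   T range over [semigroupType] is no restriction. *)
Definition s_indecomposable (S : semigroupType) : Prop :=
  forall (T : semigroupType) (f : {multiplicative S -> T}),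
    is_semilattice T -> (forall t : T, exists s : S, f s = t) ->
    exists t : T, forall u : T, u = t.

Definition is_sgideal (S : finSemigroupType) (I : {set S}) : bool :=
  (I != set0) &&
  [forall x in I, forall s : S, ((s * x)%g \in I) && ((x * s)%g \in I)].

Record sgideal (S : finSemigroupType) := SgIdeal {
  sgideal_set :> {set S};
  sgidealP : is_sgideal sgideal_set
}.

Section SemigroupIdeals.
Variable S : finSemigroupType.
Implicit Types (I : sgideal S) (s x y : S).

Lemma sgideal_neq0 I : exists x, x \in (I : {set S}).
Proof. by case/andP: (sgidealP I) => /set0Pn. Qed.

Lemma sgidealMl I s x : x \in (I : {set S}) -> (s * x)%g \in (I : {set S}).
Proof.
by move=> xI; case/andP: (sgidealP I) => _ /forall_inP/(_ x xI)/forallP/(_ s)/andP[].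
Qed.

Lemma sgidealMr I s x : x \in (I : {set S}) -> (x * s)%g \in (I : {set S}).
Proof.
by move=> xI; case/andP: (sgidealP I) => _ /forall_inP/(_ x xI)/forallP/(_ s)/andP[].
Qed.

Lemma is_sgidealT : is_sgideal [set: S].
Proof.
apply/andP; split; first by rewrite -card_gt0 cardsT; exact: card_gt0_subproof.
by apply/forall_inP => x _; apply/forallP => s; rewrite !inE.
Qed.

Lemma minimal_sgideal_exists : exists K : {set S}, minset (@is_sgideal S) K.
Proof. by have [K minK _] := minset_exists is_sgidealT; exists K. Qed.

Definition kernel : sgideal S :=
  SgIdeal (minsetp (xchooseP minimal_sgideal_exists)).

Lemma kernel_minset : minset (@is_sgideal S) kernel.
Proof. exact: (xchooseP minimal_sgideal_exists). Qed.

Lemma kernel_sub I : kernel \subset I.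
Proof.
suff KI : is_sgideal (kernel :&: I).
  have <- := minsetinf kernel_minset KI (subsetIl _ _); exact: subsetIr.
have [k kK] := sgideal_neq0 kernel; have [i iI] := sgideal_neq0 I.
apply/andP; split.
  by apply/set0Pn; exists (k * i)%g; rewrite inE sgidealMr ?sgidealMl.
apply/forall_inP => x; rewrite inE => /andP[xK xI].
by apply/forallP => s; rewrite !in_setI 2?(sgidealMl s) 2?(sgidealMr s).
Qed.

Lemma kernel_unique (K : {set S}) : minset (@is_sgideal S) K -> K = kernel.
Proof.
move=> minK; apply/esym/(minsetinf minK (sgidealP kernel)).
exact: (kernel_sub (SgIdeal (minsetp minK))).
Qed.

End SemigroupIdeals.

(* [None] is the class of [I], the zero of S / I. *)

Definition rees (S : finSemigroupType) (I : sgideal S) : Type :=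
  option {x : S | x \notin (I : {set S})}.

HB.instance Definition _ S I := Finite.on (@rees S I).

Section Rees.
Variables (S : finSemigroupType) (I : sgideal S).
Implicit Types (x y : S) (a b c : rees I).

Definition rees_pi x : rees I := insub x.

Definition rees_mul a b : rees I :=
  match a, b with
  | Some x, Some y => rees_pi (val x * val y)%g
  | _, _ => None
  end.

Lemma rees_pi0 x : x \in (I : {set S}) -> rees_pi x = None.
Proof. by move=> xI; rewrite /rees_pi insubN // negbK. Qed.

Lemma rees_pi_surj a : exists x, rees_pi x = a.
Proof.
case: a => [u|]; first by exists (val u); exact: valK.
by have [x xI] := sgideal_neq0 I; exists x; exact: rees_pi0.
Qed.

Lemma rees_pi_eq x y :
  rees_pi x = rees_pi y <->
  x = y \/ (x \in (I : {set S})) /\ (y \in (I : {set S})).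
Proof.
split=> [|[->//|[xI yI]]]; last by rewrite !rees_pi0.
rewrite /rees_pi; case: insubP => [u _ <-|]; case: insubP => [v _ <-|] //.
  by case=> ->; left.
by rewrite !negbK => yI xI _; right.
Qed.

Lemma rees_mul_pi x y : rees_mul (rees_pi x) (rees_pi y) = rees_pi (x * y)%g.
Proof.
have [xI|xI] := boolP (x \in (I : {set S})).
  by rewrite (rees_pi0 xI) (rees_pi0 (sgidealMr y xI)).
have [yI|yI] := boolP (y \in (I : {set S})).
  by rewrite (rees_pi0 yI) (rees_pi0 (sgidealMl x yI)); case: (rees_pi x).
by rewrite /rees_mul {1 2}/rees_pi (insubT (fun z => z \notin _) xI)
  (insubT (fun z => z \notin _) yI).
Qed.

Lemma rees_mulA : associative rees_mul.
Proof.
move=> a b c.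
have [[x <-] [y <-]] := (rees_pi_surj a, rees_pi_surj b).
by have [z <-] := rees_pi_surj c; rewrite !rees_mul_pi mulgA.
Qed.

Lemma rees_card_gt0 : (0 < #|{: rees I}|)%N.
Proof. by apply/card_gt0P; exists None. Qed.

HB.instance Definition _ := isSemigroup.Build (rees I) rees_mulA.
HB.instance Definition _ := Finite_isNonempty.Build (rees I) rees_card_gt0.

Lemma rees_piM x y : rees_pi (x * y)%g = (rees_pi x * rees_pi y)%g.
Proof. by rewrite -rees_mul_pi. Qed.

End Rees.

(* MathComp algebras are unital; these need not be. *)

HB.mixin Record Vector_isAssocAlg (K : fieldType) A of Vector K A := {
  amul : A -> A -> A;
  amulA : associative amul;
  amulDl : left_distributive amul +%R;
  amulDr : right_distributive amul +%R;
  amulZl : forall (k : K) (x y : A), amul (k *: x) y = k *: amul x y;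
  amulZr : forall (k : K) (x y : A), amul x (k *: y) = k *: amul x y
}.

#[short(type="assocAlgType")]
HB.structure Definition AssocAlg (K : fieldType) :=
  {A of Vector K A & Vector_isAssocAlg K A}.

Definition is_algideal (K : fieldType) (A : assocAlgType K) (I : {vspace A}) :
    Prop :=
  forall a x : A, x \in I -> amul a x \in I /\ amul x a \in I.

Record algideal (K : fieldType) (A : assocAlgType K) := AlgIdeal {
  algideal_space :> {vspace A};
  algidealP : is_algideal algideal_space
}.

Section Algebra.
Variables (K : fieldType) (A : assocAlgType K).
Implicit Types (x y z a b : A) (U V W I : {vspace A}).

Lemma amul0l x : amul 0 x = 0.
Proof. by rewrite -[X in amul X _](scale0r (0 : A)) amulZl scale0r. Qed.

Lemma amul0r x : amul x 0 = 0.
Proof. by rewrite -[X in amul _ X](scale0r (0 : A)) amulZr scale0r. Qed.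

Lemma amulNl x y : amul (- x) y = - amul x y.
Proof. by rewrite -scaleN1r amulZl scaleN1r. Qed.

Lemma amulNr x y : amul x (- y) = - amul x y.
Proof. by rewrite -scaleN1r amulZr scaleN1r. Qed.

(* [iter n (amul x) x] is the power x^(n+1). *)
Definition nilpotent x : Prop := exists n, iter n (amul x) x = 0.

Definition properly_nilpotent x : Prop := forall a, nilpotent (amul a x).

Definition nilpotent_space I : Prop :=
  exists n, forall (s : seq A) x,
    size s = n -> {subset s <= I} -> x \in I -> foldr amul x s = 0.

(* The properly nilpotent elements form a subspace: they are the elements
   annihilating every simple subquotient V / U of the left A-module A. *)

Let stable V := forall a v, v \in V -> amul a v \in V.

Let maxpair V U :=
  [/\ stable U, (U <= V)%VS, U <> V &
      forall W, stable W -> (U <= W)%VS -> (W <= V)%VS -> W = U \/ W = V].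

Let annih z := forall V U, stable V -> maxpair V U ->
  forall v, v \in V -> amul z v \in U.

Let rmul v : A -> A := fun a => amul a v.

Let rmul_linear v : linear (rmul v).
Proof. by move=> k x y; rewrite /rmul amulDl amulZl. Qed.

HB.instance Definition _ v :=
  GRing.isLinear.Build K A A _ (rmul v) (rmul_linear v).

Let orbit v := limg (linfun (rmul v)).

Let orbitP v w : reflect (exists a, w = amul a v) (w \in orbit v).
Proof.
apply: (iffP memv_imgP) => [[a _ ->]|[a ->]]; exists a.
- by rewrite lfunE.
- exact: memvf.
- by rewrite lfunE.
Qed.

Let stable_orbit v U : stable U -> stable (orbit v + U)%VS.
Proof.
move=> sU a w /memv_addP[p /orbitP[b ->] [u uU ->]].
rewrite amulDr amulA; apply: memv_add; last exact: sU.
by apply/orbitP; exists (amul a b).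
Qed.

Let nilp_absorb U b v : stable U -> nilpotent b -> v - amul b v \in U ->
  amul b v \in U.
Proof.
move=> sU [n bn0] dU.
suff step k : amul b v - amul (iter k (amul b) b) v \in U.
  by have := step n; rewrite bn0 amul0l subr0.
elim: k => [|k IH]; first by rewrite subrr mem0v.
have E : amul b v - amul (iter k.+1 (amul b) b) v =
    (amul b v - amul b (amul b v)) +
    amul b (amul b v - amul (iter k (amul b) b) v).
  by rewrite amulDr amulNr addrA subrK /= -amulA.
rewrite E; apply: memvD; last exact: sU.
have -> : amul b v - amul b (amul b v) = amul b (v - amul b v).
  by rewrite amulDr amulNr.
exact: sU.
Qed.

Let pn_annih x : properly_nilpotent x -> annih x.
Proof.
move=> px V U sV [sU UV UneV maxU] v vV; apply/negPn/negP => xvU.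
have xvV : amul x v \in V by exact: sV.
have oV : (orbit (amul x v) + U <= V)%VS.
  rewrite subv_add UV andbT; apply/subvP => w /orbitP[a ->]; exact: sV.
have [oE|oE] := maxU _ (@stable_orbit (amul x v) _ sU) (addvSr _ _) oV.
  (* A x v lies in U, so <[x v]> + U is stable *)
  have AxvU a : amul a (amul x v) \in U.
    by rewrite -oE -[amul a _]addr0 memv_add ?mem0v //; apply/orbitP; exists a.
  have sL : stable (<[amul x v]> + U)%VS.
    move=> a w /memv_addP[p /vlineP[k ->] [u uU ->]].
    rewrite -[amul a _]add0r memv_add ?mem0v // amulDr amulZr.
    by apply: memvD; [exact: memvZ | exact: sU].
  have LV : (<[amul x v]> + U <= V)%VS by rewrite subv_add UV -memvE xvV.
  have [LE|LE] := maxU _ sL (addvSr _ _) LV.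
    by case/negP: xvU; rewrite -LE memvE addvSl.
  move: vV; rewrite -LE => /memv_addP[p /vlineP[k ->] [u uU vE]].
  case/negP: xvU; rewrite [X in amul x X]vE amulDr amulZr.
  by apply: memvD; [apply/memvZ/AxvU | exact: sU].
move: (vV); rewrite -oE => /memv_addP[p /orbitP[a ->] [u uU vE]].
have bvU : amul (amul a x) v \in U.
  apply: nilp_absorb sU (px a) _.
  by rewrite [X in X - _]vE amulA addrC addKr.
case/negP: xvU; apply: sU; rewrite vE amulA; exact: memvD.
Qed.

Let maxpair_exists V : stable V -> V <> 0%VS -> exists U, maxpair V U.
Proof.
move=> sV Vn0.
pose P d := `[< exists U, [/\ stable U, (U <= V)%VS, U <> V & \dim U = d] >].
have P0 : exists d, P d.
  exists 0; apply/asboolP; exists 0%VS; split.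
  - by move=> a v; rewrite memv0 => /eqP->; rewrite amul0r mem0v.
  - exact: sub0v.
  - by move=> E; apply: Vn0.
  - exact: dimv0.
have bP d : P d -> (d <= \dim V)%N.
  by move=> /asboolP[U [_ UV _ <-]]; exact: dimvS.
case: (ex_maxnP P0 bP) => d /asboolP[U [sU UV UneV dU]] maxd.
exists U; split=> // W sW UW WV; have [WE|WE] := EM (W = V); [by right | left].
apply/esym/eqP; rewrite eqEdim UW dU; apply: maxd; apply/asboolP.
by exists W.
Qed.

Let annih_kill V : stable V -> exists n, forall s v,
  size s = n -> (forall z, z \in s -> annih z) -> v \in V -> foldr amul v s = 0.
Proof.
have [d] := ubnP (\dim V); elim: d V => // d IH V dV sV.
have [->|Vn0] := EM (V = 0%VS).
  by exists 0 => -[|//] v _ _; rewrite memv0 => /eqP->.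
have [U mU] := maxpair_exists sV Vn0.
have [sU UV UneV _] := mU.
have [||n kn] := IH U => //.
  apply: leq_trans (_ : \dim V <= d)%N => //.
  rewrite ltn_neqAle dimvS // andbT; apply/eqP => E.
  by apply: UneV; apply/eqP; rewrite eqEdim UV E leqnn.
exists n.+1 => s v; case/lastP: s => [//|s z]; rewrite size_rcons => -[sn] As vV.
rewrite foldr_rcons; apply: kn => // [y ys|].
  by apply: As; rewrite mem_rcons inE ys orbT.
by apply: (As z _ V U) => //; rewrite mem_rcons mem_head.
Qed.

Let annih_pn x : annih x -> properly_nilpotent x.
Proof.
move=> Ax a; have sT : stable fullv by move=> *; exact: memvf.
have [n kn] := annih_kill sT; exists n.
have <- : foldr amul (amul a x) (nseq n (amul a x)) = iter n (amul (amul a x)) (amul a x).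
  by elim: n {kn} => //= n ->.
apply: kn; rewrite ?size_nseq ?memvf // => z /nseqP[-> _] V U sV mU v vV.
by rewrite -amulA; case: (mU) => sU _ _ _; apply/sU/(Ax V U).
Qed.

Lemma properly_nilpotent_space :
  exists J : {vspace A}, forall x, x \in J <-> properly_nilpotent x.
Proof.
have pnE x : properly_nilpotent x <-> annih x by split; [exact: pn_annih | exact: annih_pn].
pose P d := `[< exists2 J : {vspace A}, (forall x, x \in J -> annih x) & \dim J = d >].
have P0 : exists d, P d.
  exists 0; apply/asboolP; exists 0%VS; last exact: dimv0.
  by move=> x; rewrite memv0 => /eqP-> V U *; rewrite amul0l mem0v.
have bP d : P d -> (d <= \dim {:A})%N.
  by move=> /asboolP[U _ <-]; exact/dimvS/subvf.
case: (ex_maxnP P0 bP) => d /asboolP[J AJ dJ] maxd.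
exists J => x; rewrite pnE; split=> [|Ax]; first exact: AJ.
have JE : J = (<[x]> + J)%VS.
  apply/eqP; rewrite eqEdim addvSr dJ; apply: maxd; apply/asboolP.
  exists (<[x]> + J)%VS => // y /memv_addP[p /vlineP[k ->] [u uJ ->]] V U sV mU v vV.
  by rewrite amulDl amulZl memvD ?memvZ ?(Ax V U) ?(AJ u uJ V U).
by rewrite JE memvE addvSl.
Qed.

Definition jacobson_space : {vspace A} := projT1 (cid properly_nilpotent_space).

Lemma jacobson_spaceP x : x \in jacobson_space <-> properly_nilpotent x.
Proof. exact: (projT2 (cid properly_nilpotent_space)). Qed.

Lemma jacobson_ideal : is_algideal jacobson_space.
Proof.
move=> a x /jacobson_spaceP/pn_annih Ax.
split; apply/jacobson_spaceP/annih_pn => V U sV mU v vV; rewrite -amulA.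
  by case: (mU) => sU _ _ _; apply/sU/(Ax V U).
by apply: (Ax V U) => //; exact: sV.
Qed.

Definition jacobson : algideal A := AlgIdeal jacobson_ideal.

Lemma mem_jacobson x : x \in (jacobson : {vspace A}) <-> properly_nilpotent x.
Proof. exact: jacobson_spaceP. Qed.

Lemma jacobson_nilpotent : nilpotent_space jacobson.
Proof.
have sT : stable fullv by move=> *; exact: memvf.
have [n kn] := annih_kill sT; exists n => s x sn sJ xJ; apply: kn => // [z zs|].
  by apply: pn_annih; apply/mem_jacobson; exact: sJ.
exact: memvf.
Qed.

Lemma jacobson_max I : is_algideal I -> nilpotent_space I -> (I <= jacobson)%VS.
Proof.
move=> idI [n kn]; apply/subvP => x xI; apply/mem_jacobson => a; exists n.
have axI : amul a x \in I by case: (idI a x xI).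
rewrite -[RHS](kn (nseq n (amul a x)) (amul a x)) ?size_nseq //.
  by elim: n {kn} => //= n ->.
by move=> z /nseqP[-> _].
Qed.

End Algebra.

(* A / I is carried by a chosen complement of [I]; [quot_pi], the projection along
   [I], is a surjective algebra morphism with kernel [I]. *)

Definition quotalg (K : fieldType) (A : assocAlgType K) (I : algideal A) : Type :=
  subvs_of (I^C)%VS.

HB.instance Definition _ K A I := Vector.on (@quotalg K A I).

Section Quotient.
Variables (K : fieldType) (A : assocAlgType K) (I : algideal A).
Implicit Types (x y : A) (p q : quotalg I).

Definition quot_pi x : quotalg I := vsproj (I^C)%VS (daddv_pi (I^C)%VS I x).

Definition quot_mul p q : quotalg I := quot_pi (amul (vsval p) (vsval q)).

Lemma quot_pi_is_linear : linear quot_pi.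
Proof. by move=> k x y; rewrite /quot_pi !linearP. Qed.

HB.instance Definition _ :=
  GRing.isLinear.Build K A (quotalg I) _ quot_pi quot_pi_is_linear.

Let capCI : ((I^C)%VS :&: I = 0)%VS.
Proof. by rewrite capvC capv_compl. Qed.

Lemma quot_piK p : quot_pi (vsval p) = p.
Proof. by rewrite /quot_pi daddv_pi_id ?subvsP ?vsvalK. Qed.

Lemma quot_pi_repr x : x - vsval (quot_pi x) \in (I : {vspace A}).
Proof.
rewrite /quot_pi vsprojK ?memv_pi //.
rewrite -{1}[x](daddv_pi_add capCI) ?addrK 1?addrC ?addKr ?memv_pi //.
by rewrite addvC addv_complf memvf.
Qed.

Lemma quot_pi_eq0 x : (quot_pi x == 0) = (x \in (I : {vspace A})).
Proof.
apply/eqP/idP => [E|xI].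
  by have := quot_pi_repr x; rewrite E [vsval 0](linear0 vsval) subr0.
apply/eqP; rewrite -[_ == 0](inj_eq val_inj) /=.
have : vsval (quot_pi x) \in ((I^C)%VS :&: I)%VS.
  rewrite memv_cap subvsP /= -[vsval _](subKr x).
  by rewrite memvB ?quot_pi_repr.
by rewrite capCI memv0.
Qed.

Lemma quot_pi_eq x y : quot_pi x = quot_pi y <-> x - y \in (I : {vspace A}).
Proof.
rewrite -quot_pi_eq0 raddfB subr_eq0; exact: rwP eqP.
Qed.

Lemma quot_mul_pi x y : quot_mul (quot_pi x) (quot_pi y) = quot_pi (amul x y).
Proof.
apply/quot_pi_eq; set x' := vsval _; set y' := vsval _.
have -> : amul x' y' - amul x y = - (amul x' (y - y') + amul (x - x') y).
  rewrite amulDr amulDl amulNl amulNr -[LHS]opprB.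
  by congr (- _); rewrite [RHS]addrC addrA subrK.
have [dx dy] := (quot_pi_repr x, quot_pi_repr y).
rewrite rpredN rpredD //.
  by have [] := algidealP x' dy.
by have [] := algidealP y dx.
Qed.

Lemma quot_mulA : associative quot_mul.
Proof.
move=> p q r; rewrite -[p]quot_piK -[q]quot_piK -[r]quot_piK.
by rewrite !quot_mul_pi amulA.
Qed.

Lemma quot_mulDl : left_distributive quot_mul +%R.
Proof. by move=> p q r; rewrite /quot_mul -raddfD -amulDl. Qed.

Lemma quot_mulDr : right_distributive quot_mul +%R.
Proof. by move=> p q r; rewrite /quot_mul -raddfD -amulDr. Qed.

Lemma quot_mulZl (k : K) p q : quot_mul (k *: p) q = k *: quot_mul p q.
Proof. by rewrite /quot_mul -linearZ -amulZl. Qed.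

Lemma quot_mulZr (k : K) p q : quot_mul p (k *: q) = k *: quot_mul p q.
Proof. by rewrite /quot_mul -linearZ -amulZr. Qed.

HB.instance Definition _ := Vector_isAssocAlg.Build K (quotalg I)
  quot_mulA quot_mulDl quot_mulDr quot_mulZl quot_mulZr.

Lemma quot_piM x y : quot_pi (amul x y) = amul (quot_pi x) (quot_pi y).
Proof. by rewrite -quot_mul_pi. Qed.

End Quotient.

(* Non-contracted semigroup algebra K[T]: [f] stands for the formal sum
   of the [f t] t; the product is convolution. *)

Definition sgalg (K : fieldType) (T : finSemigroupType) : Type :=
  {ffun T -> K^o}.

HB.instance Definition _ K T := Vector.on (@sgalg K T).

Section SemigroupAlgebra.
Variables (K : fieldType) (T : finSemigroupType).
Implicit Types (f g h : sgalg K T) (s t u : T).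

Definition sgalg_basis t : sgalg K T := [ffun s => (s == t)%:R].

Definition sgalg_mul f g : sgalg K T :=
  [ffun t => \sum_s \sum_(u | (s * u)%g == t) f s * g u].

Lemma sgalg_mulDl : left_distributive sgalg_mul +%R.
Proof.
move=> f g h; apply/ffunP => t; rewrite !ffunE -big_split; apply: eq_bigr => s _.
by rewrite -big_split; apply: eq_bigr => u _; rewrite !ffunE mulrDl.
Qed.

Lemma sgalg_mulDr : right_distributive sgalg_mul +%R.
Proof.
move=> f g h; apply/ffunP => t; rewrite !ffunE -big_split; apply: eq_bigr => s _.
by rewrite -big_split; apply: eq_bigr => u _; rewrite !ffunE mulrDr.
Qed.

Lemma sgalg_mulZl (k : K) f g : sgalg_mul (k *: f) g = k *: sgalg_mul f g.
Proof.
apply/ffunP => t; rewrite !ffunE scaler_sumr; apply: eq_bigr => s _.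
by rewrite scaler_sumr; apply: eq_bigr => u _; rewrite !ffunE -scalerAl.
Qed.

Lemma sgalg_mulZr (k : K) f g : sgalg_mul f (k *: g) = k *: sgalg_mul f g.
Proof.
apply/ffunP => t; rewrite !ffunE scaler_sumr; apply: eq_bigr => s _.
by rewrite scaler_sumr; apply: eq_bigr => u _; rewrite !ffunE -scalerAr.
Qed.

Lemma sgalg_mul_basis s t :
  sgalg_mul (sgalg_basis s) (sgalg_basis t) = sgalg_basis (s * t)%g.
Proof.
apply/ffunP => u; rewrite !ffunE (bigD1 s) //= [X in _ + X]big1 ?addr0.
  rewrite ffunE eqxx; under eq_bigr do rewrite ffunE mul1r.
  rewrite big_mkcond (bigD1 t) //= [X in _ + X]big1 ?addr0 ?eqxx.
    by rewrite eq_sym; case: ifP.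
  by move=> v /negbTE->; case: ifP.
by move=> v /negbTE vs; apply: big1 => w _; rewrite !ffunE vs mul0r.
Qed.

Lemma sgalg_expand f : f = \sum_t f t *: sgalg_basis t.
Proof.
apply/ffunP => u; rewrite sum_ffunE (bigD1 u) //= [X in _ + X]big1 ?addr0.
  by rewrite !ffunE eqxx /GRing.scale /= mulr1.
by move=> t; rewrite eq_sym => /negbTE tu; rewrite !ffunE tu scaler0.
Qed.

Lemma sgalg_mulA : associative sgalg_mul.
Proof.
have suml (I : finType) (F : I -> sgalg K T) g :
    sgalg_mul (\sum_i F i) g = \sum_i sgalg_mul (F i) g.
  apply: (big_morph (sgalg_mul^~ g)) => [? ?|]; first exact: sgalg_mulDl.
  by rewrite -[X in sgalg_mul X _](scale0r (0 : sgalg K T)) sgalg_mulZl scale0r.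
have sumr (I : finType) (F : I -> sgalg K T) g :
    sgalg_mul g (\sum_i F i) = \sum_i sgalg_mul g (F i).
  apply: (big_morph (sgalg_mul g)) => [? ?|]; first exact: sgalg_mulDr.
  by rewrite -[X in sgalg_mul _ X](scale0r (0 : sgalg K T)) sgalg_mulZr scale0r.
move=> f g h; rewrite [f]sgalg_expand [g]sgalg_expand [h]sgalg_expand.
rewrite !suml; apply: eq_bigr => s _; rewrite sumr [X in _ = sgalg_mul X _]sumr suml.
apply: eq_bigr => t _; rewrite !sumr; apply: eq_bigr => u _.
rewrite !(sgalg_mulZl, sgalg_mulZr) !sgalg_mul_basis mulgA !scalerA.
by congr (_ *: _); rewrite -[RHS]mulrA [RHS]mulrC.
Qed.

HB.instance Definition _ := Vector_isAssocAlg.Build K (sgalg K T)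
  sgalg_mulA sgalg_mulDl sgalg_mulDr sgalg_mulZl sgalg_mulZr.

Lemma sgalg_basisM s t :
  sgalg_basis (s * t)%g = amul (sgalg_basis s) (sgalg_basis t).
Proof. by rewrite -sgalg_mul_basis. Qed.

End SemigroupAlgebra.

(* Main.v *)
Require Import Defs.
From mathcomp Require Import all_boot all_order all_algebra reals complex.
From HB Require Import structures.
From mathcomp Require Import boolp.

(** Both sides of the equivalence are statements about characters, that is,
    nonzero multiplicative maps to the field of scalars.

    On the algebra side, a one-dimensional ideal [I] of [A / J(A)] is a line on
    which [A] acts by scalars.  Because [A / J(A)] has no nonzero nilpotent ideal,
    a generator of [I] is not killed by the linear form that describes the left
    action; this forces the left and right actions to agree and the form to be a
    character, and it shows that two lines with the same character coincide
    ([line_affords], [affords_inj]).  Conversely every character [chi] of [A]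
    occurs ([character_affords]): choose a left ideal [L] minimal among those
    that [chi] does not kill.  A Fitting argument makes every element of
    [L] with [chi = 0] nilpotent ([minimal_left_ideal_nilpotent]), so that [L]
    has a one-dimensional image in [A / J(A)], and this image is an ideal.  So
    one-dimensional ideals of [A / J(A)] correspond to characters of [A],
    over any field and without the Wedderburn structure theorem.

    Characters of a semigroup algebra are characters of the semigroup, the
    constant [1] being one of them.  Hence [K[S / K_S] / J] has exactly one
    one-dimensional ideal if and only if [1] is the only character of [S / K_S]
    ([unique_line_sgcharacter]).

    On the semigroup side, semilattices are separated by their morphisms to the
    two-element semilattice, so [S] is s-indecomposable if and only if every
    morphism from [S] to ([bool], [&&]) is constant ([s_indecomposableP]).  A
    character of [S / K_S] yields such a morphism by recording where it does not
    vanish, and when it vanishes nowhere the zero of [S / K_S] forces it to be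
    [1].  A nonconstant morphism to [bool] is [false] on the minimal ideal
    [K_S], hence descends to a character of [S / K_S] that vanishes at the
    zero. *)

Set Implicit Arguments.
Unset Strict Implicit.
Unset Printing Implicit Defensive.

Import GRing.Theory.
Local Open Scope ring_scope.

(** * Powers and nilpotency *)

Section Powers.
Variables (K : fieldType) (A : assocAlgType K).
Implicit Types x : A.

(** The algebra need not have a unit, so the exponent is shifted: [pow n x] is the power
    of [x] of exponent [n.+1]. *)
Definition pow n x : A := iter n (amul x) x.

Lemma powM m n x : amul (pow m x) (pow n x) = pow (m + n).+1 x.
Proof. by elim: m => //= m IH; rewrite -amulA IH. Qed.

Lemma nilpotent_pow m x : nilpotent (pow m x) -> nilpotent x.
Proof.
case=> n; suff [k ->] : exists k, iter n (amul (pow m x)) (pow m x) = pow k x.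
  by exists k.
elim: n => [|n [k /= ->]]; first by exists m.
by rewrite powM; exists (m + k).+1.
Qed.

(** If the square of [x] is properly nilpotent then the fourth power of [x] is
    nilpotent, being a multiple of that square. *)
Lemma nilpotent_sqr_jacobson x :
  amul x x \in (jacobson A : {vspace A}) -> nilpotent x.
Proof.
move=> /mem_jacobson/(_ (amul x x)); rewrite -[amul x x]/(pow 1 x) powM.
exact: nilpotent_pow.
Qed.

End Powers.

(** * Characters and one-dimensional ideals modulo the radical *)

Section Characters.
Variables (K : fieldType) (A : assocAlgType K).
Implicit Types (a b x y z w : A) (L : {vspace A}) (chi psi : {scalar A}).

Local Notation B := (quotalg (jacobson A)).
Local Notation p := (@quot_pi K A (jacobson A)).

Definition character chi : Prop :=
  (forall x y, chi (amul x y) = chi x * chi y) /\ exists a, chi a != 0.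

Definition affords chi (I : {vspace B}) : Prop :=
  forall a v, v \in I ->
    amul (p a) v = chi a *: v /\ amul v (p a) = chi a *: v.

Lemma character_nilpotent chi x : character chi -> nilpotent x -> chi x = 0.
Proof.
case=> chiM _ [n]; suff E : chi (pow n x) = chi x ^+ n.+1.
  move=> /(congr1 chi); rewrite E linear0 => /eqP.
  by rewrite expf_eq0 => /eqP.
by elim: n => //= n IH; rewrite chiM IH [RHS]exprS.
Qed.

(** If [chi a != 0] and [x] lies in the radical, then [a x] is nilpotent, so
    [chi a * chi x] vanishes. *)
Lemma character_jacobson chi x : character chi ->
  x \in (jacobson A : {vspace A}) -> chi x = 0.
Proof.
move=> cchi /mem_jacobson px; have [chiM [a a0]] := cchi.
have /eqP := character_nilpotent cchi (px a).
by rewrite chiM mulf_eq0 (negbTE a0) => /eqP.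
Qed.

(** Semisimplicity of the quotient enters through this lemma.  Modulo the
    radical, [w w = chi w w = 0], so that [(a w)(a w) = chi a (a (w w)) = 0] for
    each [a]; thus [w] is properly nilpotent. *)
Lemma eigenvector_eq0 chi w :
    (forall a, amul (p a) (p w) = chi a *: p w) -> chi w = 0 -> p w = 0.
Proof.
move=> lw w0; apply/eqP; rewrite quot_pi_eq0; apply/mem_jacobson => a.
apply: nilpotent_sqr_jacobson; rewrite -quot_pi_eq0.
rewrite !quot_piM -amulA lw amulZr lw w0 scale0r scaler0.
by rewrite amul0r.
Qed.

Lemma affords_neq0 chi (I : {vspace B}) x :
  affords chi I -> p x \in I -> p x != 0 -> chi x != 0.
Proof.
move=> aI xI; apply: contraNneq => x0; apply/eqP/(eigenvector_eq0 _ x0) => a.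
by case: (aI a (p x) xI).
Qed.

(** For [x] and [y] representing elements of the two lines, [x y] is both
    [chi x y] and [chi y x] modulo the radical, and [chi y != 0] if [y] is not
    in the radical. *)
Lemma affords_inj chi (I I' : {vspace B}) :
  \dim I = 1%N -> \dim I' = 1%N -> affords chi I -> affords chi I' -> I = I'.
Proof.
suff sub (U V : {vspace B}) : \dim V = 1%N -> affords chi U -> affords chi V ->
    (U <= V)%VS.
  by move=> d d' a a'; apply/eqP; rewrite eqEdim sub // d d'.
move=> dV aU aV; apply/subvP => u; rewrite -[u]quot_piK => uU.
have : vpick V != 0 by rewrite vpick0 -dimv_eq0 dV.
have := memv_pick V; rewrite -[vpick V]quot_piK.
set x := vsval u; set y := vsval _ => yV y0.
have y1 := affords_neq0 aV yV y0.
have E : chi x *: p y = chi y *: p x.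
  by rewrite -(aV x _ yV).1 -(aU y _ uU).2.
by rewrite -[p x](scalerK y1) -E memvZ // memvZ.
Qed.

(** The left and right actions on the line are scalar, by [l] and [r] say, and
    they agree because [v (b v) = (v b) v] with [v v != 0]. *)
Lemma line_affords (I : {vspace B}) : is_algideal I -> \dim I = 1%N ->
  exists chi, character chi /\ affords chi I.
Proof.
move=> idI dI.
have v0 : vpick I != 0 by rewrite vpick0 -dimv_eq0 dI.
have vI := memv_pick I; set v := vpick I in v0 vI.
have IE : I = <[v]>%VS.
  by apply/esym/eqP; rewrite eqEdim -memvE vI dim_vline v0 dI.
have mult u : u \in I -> exists k, u = k *: v by rewrite IE => /vlineP.
have [l lE] : {l : B -> K & forall q, amul q v = l q *: v}.
  apply: (@choice B K (fun q k => amul q v = k *: v)) => q.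
  by apply: mult; case: (idI q v vI).
have [r rE] : {r : B -> K & forall q, amul v q = r q *: v}.
  apply: (@choice B K (fun q k => amul v q = k *: v)) => q.
  by apply: mult; case: (idI q v vI).
have inj (k k' : K) : k *: v = k' *: v -> k = k'.
  by move/eqP; rewrite -subr_eq0 -scalerBl scaler_eq0 (negbTE v0) orbF
    subr_eq0 => /eqP.
have linl : linear_for *%R (fun a : A => l (p a)).
  move=> k a b; apply: inj; rewrite -lE linearP amulDl amulZl !lE.
  by rewrite scalerA -scalerDl.
pose chi : {scalar A} := HB.pack (fun a : A => l (p a))
  (GRing.isLinear.Build K A K *%R _ linl).
have lv (w : B) : w \in I -> forall a, amul (p a) w = chi a *: w.
  by rewrite IE => /vlineP[k ->] a; rewrite amulZr lE !scalerA mulrC.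
have [x xv] : exists x, p x = v by exists (vsval v); exact: quot_piK.
have x1 : chi x != 0.
  apply: contra_neq v0 => x0; rewrite -xv; apply: (@eigenvector_eq0 chi) => // a.
  by rewrite lv // xv.
have rl (b : B) : r b = l b.
  have := amulA v b v; rewrite (lE b) (rE b) amulZr amulZl.
  move: (lv v vI x); rewrite xv => ->.
  by rewrite !scalerA => /inj; move/(mulIf x1).
exists chi; split.
  split=> [a b|]; last by exists x.
  by apply: inj; rewrite -lE quot_piM -amulA lE amulZr lE scalerA mulrC.
move=> a w wI; split; first exact: lv.
by move: wI; rewrite IE => /vlineP[k ->]; rewrite amulZl rE rl !scalerA mulrC.
Qed.

Definition left_ideal L : Prop := forall a x, x \in L -> amul a x \in L.

Definition rmul y a : A := amul a y.

Lemma rmul_linear y : linear (rmul y).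
Proof. by move=> k a b; rewrite /rmul amulDl amulZl. Qed.

HB.instance Definition _ y := GRing.isLinear.Build K A A _ (rmul y) (rmul_linear y).

(** Fitting's argument.  The chain of the spaces [L y^k] becomes stationary, so
    with [chi z != 0] we get [z y^k = z' y^(k + 1)] for some [z'] in [L], that
    is, [z - z' y] lies in the left ideal of the elements of [L] killed by
    [y^k].  As [chi (z - z' y) = chi z], minimality makes that ideal all of [L];
    in particular it contains [y]. *)
Lemma minimal_left_ideal_nilpotent chi L y : character chi -> left_ideal L ->
    (exists2 z, z \in L & chi z != 0) ->
    (forall N : {vspace A}, left_ideal N -> (N <= L)%VS ->
       (exists2 z, z \in N & chi z != 0) -> N = L) ->
  y \in L -> chi y = 0 -> nilpotent y.
Proof.
move=> [chiM _] idL [z zL z1] minL yL y0.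
pose F k := (linfun (rmul (pow k y)) @: L)%VS.
(* The spaces [F k] decrease: choose one of least dimension. *)
have [k [kF]] : exists k, F k.+1 = F k.
  have P0 : exists d, `[< exists k, \dim (F k) = d >].
    by exists (\dim (F 0)); apply/asboolP; exists 0.
  case: (ex_minnP P0) => d /asboolP[k <-] mind; exists k.
  apply/eqP; rewrite eqEdim mind; last by apply/asboolP; exists k.+1.
  rewrite andbT; apply/subvP => _ /memv_imgP[x xL ->].
  apply/memv_imgP; exists (amul x y); first exact: idL.
  by rewrite !lfunE /= /rmul -amulA.
have : linfun (rmul (pow k y)) z \in F k.+1 by rewrite kF memv_img.
case/memv_imgP=> z' z'L; rewrite !lfunE /= /rmul => zE.
pose N := (L :&: lker (linfun (rmul (pow k y))))%VS.
have NE : N = L.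
  apply: minL; [|exact: capvSl|exists (z - amul z' y)].
  - move=> a x; rewrite !memv_cap !memv_ker !lfunE /= /rmul => /andP[xL /eqP x0].
    by rewrite idL // -amulA x0 amul0r eqxx.
  - rewrite memv_cap memv_ker lfunE /= /rmul amulDl amulNl -amulA zE /=.
    by rewrite subrr eqxx andbT memvB // idL.
  - by rewrite linearB /= chiM y0 mulr0 subr0.
move: yL; rewrite -NE memv_cap memv_ker lfunE /= /rmul => /andP[_ /eqP yk].
by exists k.+1.
Qed.

(** In a left ideal [L] minimal among those not killed by [chi], the elements
    killed by [chi] form a left ideal of nilpotent elements, so they vanish
    modulo the radical.  Hence any [v] in [L] with [chi v != 0] becomes an
    eigenvector of the left action, and it spans the required ideal. *)
Lemma character_affords chi : character chi ->
  exists I : {vspace B}, [/\ is_algideal I, \dim I = 1%N & affords chi I].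
Proof.
move=> cchi; have [chiM [e e1]] := cchi.
pose P d := `[< exists L, [/\ left_ideal L, exists2 z, z \in L & chi z != 0
                           & \dim L = d] >].
have P0 : exists d, P d.
  exists (\dim {:A}); apply/asboolP; exists fullv; split=> //.
    by move=> *; exact: memvf.
  by exists e; rewrite ?memvf.
case: (ex_minnP P0) => d /asboolP[L [idL exL dL]] mind.
have minL (N : {vspace A}) : left_ideal N -> (N <= L)%VS ->
    (exists2 z, z \in N & chi z != 0) -> N = L.
  move=> idN NL exN; apply/eqP; rewrite eqEdim NL dL mind //.
  by apply/asboolP; exists N.
have Lnil y : y \in L -> chi y = 0 -> p y = 0.
  move=> yL y0; apply/eqP; rewrite quot_pi_eq0; apply/mem_jacobson => a.
  apply: (minimal_left_ideal_nilpotent cchi idL) => //; first exact: idL.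
  by rewrite chiM y0 mulr0.
have [v vL v1] := exL.
have lv a : amul (p a) (p v) = chi a *: p v.
  apply/eqP; rewrite -subr_eq0 -quot_piM -linearZ -linearB; apply/eqP/Lnil.
    by rewrite memvB ?memvZ ?idL.
  by rewrite linearB linearZ /= chiM subrr.
(* [v b - chi b v] is an eigenvector on the left and is killed by [chi]. *)
have rv b : amul (p v) (p b) = chi b *: p v.
  apply/eqP; rewrite -subr_eq0 -quot_piM -linearZ -linearB; apply/eqP.
  apply: (@eigenvector_eq0 chi) => [a|].
    rewrite linearB linearZ /= quot_piM amulDr amulNr amulZr amulA lv.
    by rewrite amulZl scalerBr !scalerA mulrC.
  by rewrite linearB linearZ /= chiM mulrC subrr.
have pv0 : p v != 0.
  by rewrite quot_pi_eq0; apply: contra_neqN v1; exact: character_jacobson.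
have aff : affords chi <[p v]>%VS.
  move=> a _ /vlineP[k ->].
  by rewrite amulZl amulZr lv rv !scalerA mulrC.
exists <[p v]>%VS; split; [|by rewrite dim_vline pv0|exact: aff].
by move=> b w wI; rewrite -[b]quot_piK; case: (aff (vsval b) w wI) => -> ->;
  split; exact: memvZ.
Qed.

Lemma affords_eq chi psi (I : {vspace B}) : \dim I = 1%N ->
  affords chi I -> affords psi I -> chi =1 psi.
Proof.
move=> dI ac ap a; have v0 : vpick I != 0 by rewrite vpick0 -dimv_eq0 dI.
have vI := memv_pick I.
have /eqP := (ac a _ vI).1; rewrite (ap a _ vI).1 eq_sym -subr_eq0 -scalerBl.
by rewrite scaler_eq0 (negbTE v0) orbF subr_eq0 => /eqP.
Qed.

(** [character_affords], [line_affords], [affords_inj] and [affords_eq] make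
    one-dimensional ideals correspond bijectively to characters. *)
Lemma unique_line_character :
  (exists! I : {vspace B}, is_algideal I /\ \dim I = 1%N) <->
  (exists2 chi, character chi & forall psi, character psi -> chi =1 psi).
Proof.
split=> [[I [[idI dI] uI]]|[chi cc uc]].
  have [chi [cc ac]] := line_affords idI dI.
  exists chi => // psi cpsi; have [I' [idI' dI' ap]] := character_affords cpsi.
  by apply: (affords_eq dI ac); rewrite (uI I').
have [I [idI dI ac]] := character_affords cc.
exists I; split=> // I' [idI' dI']; have [psi [cpsi ap]] := line_affords idI' dI'.
apply: (affords_inj dI dI' ac) => a v vI'; rewrite (uc psi cpsi a); exact: ap.
Qed.

End Characters.

(** * Characters of semigroup algebras *)

Section SemigroupCharacters.
Variables (K : fieldType) (T : finSemigroupType).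

Definition sgcharacter (phi : T -> K) : Prop :=
  (forall s t, phi (s * t)%g = phi s * phi t) /\ exists t, phi t != 0.

Definition extend (phi : T -> K) (f : sgalg K T) : K := \sum_t f t * phi t.

Lemma extend_linear phi : linear_for *%R (extend phi).
Proof.
move=> k f g; rewrite /extend mulr_sumr -big_split; apply: eq_bigr => t _ /=.
by rewrite !ffunE mulrDl mulrA.
Qed.

HB.instance Definition _ phi :=
  GRing.isLinear.Build K (sgalg K T) K *%R (extend phi) (extend_linear phi).

Lemma extend_basis phi t : extend phi (sgalg_basis K t) = phi t.
Proof.
rewrite /extend (bigD1 t) //= ffunE eqxx mul1r big1 ?addr0 // => s /negbTE st.
by rewrite ffunE st mul0r.
Qed.

Lemma scalar_ext (chi psi : {scalar sgalg K T}) :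
  (forall t, chi (sgalg_basis K t) = psi (sgalg_basis K t)) -> chi =1 psi.
Proof.
move=> E f; rewrite [f]sgalg_expand !linear_sum; apply: eq_bigr => t _.
by rewrite !linearZ /= E.
Qed.

Lemma extend_character phi : sgcharacter phi ->
  character (extend phi : {scalar sgalg K T}).
Proof.
case=> phiM [t t0]; split; last by exists (sgalg_basis K t); rewrite /= extend_basis.
move=> f g /=; rewrite [f in LHS]sgalg_expand [g in LHS]sgalg_expand.
rewrite {2 3}/extend mulr_suml.
have suml (I : finType) (F : I -> sgalg K T) h :
    amul (\sum_i F i) h = \sum_i amul (F i) h.
  by apply: (big_morph (fun x => amul x h)) => [? ?|];
    rewrite ?amulDl ?amul0l.
have sumr (I : finType) (F : I -> sgalg K T) h :
    amul h (\sum_i F i) = \sum_i amul h (F i).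
  by apply: (big_morph (amul h)) => [? ?|]; rewrite ?amulDr ?amul0r.
rewrite suml linear_sum; apply: eq_bigr => s _.
rewrite mulr_sumr sumr linear_sum; apply: eq_bigr => u _.
rewrite amulZl amulZr -sgalg_basisM !linearZ /= extend_basis phiM.
by rewrite mulrA mulrACA.
Qed.

Lemma restrict_character (chi : {scalar sgalg K T}) : character chi ->
  sgcharacter (fun t => chi (sgalg_basis K t)).
Proof.
case=> chiM [f f0]; split=> [s t|]; first by rewrite sgalg_basisM chiM.
apply/existsP; apply: contraNT f0; rewrite negb_exists => /forallP z.
rewrite [f]sgalg_expand linear_sum big1 // => t _; rewrite linearZ /=.
by rewrite (eqP (negbNE (z t))) mulr0.
Qed.

(** The constant [1] is always a character, so that a unique character must be
    this one. *)
Lemma unique_line_sgcharacter :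
  (exists! I : {vspace quotalg (jacobson (sgalg K T))},
     is_algideal I /\ \dim I = 1%N) <->
  (forall phi : T -> K, sgcharacter phi -> forall t, phi t = 1).
Proof.
have c1 : sgcharacter (fun _ : T => 1 : K).
  split=> [s t|]; first by rewrite mulr1.
  by have /card_gt0P[t _] := @card_gt0_subproof T; exists t; rewrite oner_neq0.
rewrite unique_line_character; split=> [[chi _ uc] phi cphi t|u1].
  rewrite -(extend_basis phi) -(uc _ (extend_character cphi)).
  by rewrite (uc _ (extend_character c1)) /= extend_basis.
exists (extend (fun _ => 1)) => [|psi cpsi]; first exact: extend_character.
apply: scalar_ext => t /=; rewrite extend_basis.
by rewrite (u1 _ (restrict_character cpsi)).
Qed.

End SemigroupCharacters.

(** * Semilattice quotients and characters of S / K *)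

Definition bool_meet : Type := bool.
HB.instance Definition _ := Choice.on bool_meet.
HB.instance Definition _ := isSemigroup.Build bool_meet andbA.

(** A semilattice element [c] defines the morphism [x |-> (c x == c)] to
    [bool], the indicator of the filter of the elements above [c].  If all such
    morphisms are constant on [S], then any two elements of the image lie above
    each other, hence are equal. *)
Lemma s_indecomposableP (S : semigroupType) : inhabited S ->
  s_indecomposable S <->
  (forall g : S -> bool, {morph g : x y / (x * y)%g >-> x && y} ->
     forall s t, g s = g t).
Proof.
move=> [s0]; split=> [ind g gM s t|cst T f [TC Tid] fsurj].
  case: (EM (g s = g t)) => // gst.
  pose f : {multiplicative S -> bool_meet} := HB.pack (g : S -> bool_meet)
    (isMultiplicative.Build S bool_meet g gM).
  have [|b|u0 u] := ind bool_meet f.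
  - by split=> [x y|x]; [exact: andbC | exact: andbb].
  - by case: b; move: gst; rewrite /f /=;
      case gs: (g s); case gt: (g t) => // _; by [exists s | exists t].
  - by rewrite [LHS](u (g s)) [RHS](u (g t)).
have up (a b : T) : (a * b = a)%g.
  have [s <-] := fsurj a; have [t <-] := fsurj b; set c := f s.
  pose g x := (c * f x == c)%g.
  have gM : {morph g : x y / (x * y)%g >-> x && y}.
    move=> x y; rewrite /g gmulfM mulgA; apply/eqP/andP => [E|[/eqP-> /eqP->]] //.
    have Ex : (c * f x = c)%g.
      rewrite -{1}E -!mulgA [(f y * f x)%g]TC.
      by rewrite [(f x * (f x * _))%g]mulgA Tid mulgA.
    by split; apply/eqP => //; rewrite -{1}Ex.
  by have := cst g gM s t; rewrite {1}/g Tid eqxx => /esym/eqP.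
by exists (f s0) => u; rewrite -(up u (f s0)) TC up.
Qed.

(** [S] and its factor by the kernel have the same nonconstant morphisms to
    [bool], since the elements sent to [false] form an ideal, which contains the
    kernel. *)
Lemma s_indecomposable_sgcharacter (K : fieldType) (S : finSemigroupType) :
  s_indecomposable S <->
  (forall phi : rees (kernel S) -> K, sgcharacter phi -> forall t, phi t = 1).
Proof.
have iS : inhabited S by have [s _] := sgideal_neq0 (kernel S).
rewrite (s_indecomposableP iS); split=> [cst phi [phiM [t0 t00]] t|u1 g gM].
  have phi0 u : phi u != 0.
    have [x0 xt] := rees_pi_surj t0; have [x xu] := rees_pi_surj u.
    have := cst (fun x => phi (rees_pi _ x) != 0) _ x x0.
    rewrite xu xt t00 => -> // a b; by rewrite rees_piM phiM mulf_eq0 negb_or.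
  (* [None] is the zero of the factor: [phi None * phi t = phi None]. *)
  apply: (mulfI (phi0 None)); rewrite -phiM mulr1.
  by congr phi.
have [exF|gT] := pselect (exists s, ~~ g s); last first.
  have gE s : g s by apply/negPn/negP => gs; apply: gT; exists s.
  by move=> s t; rewrite !gE.
have idI : is_sgideal [set s | ~~ g s].
  apply/andP; split; first by apply/set0Pn; case: exF => s gs; exists s; rewrite inE.
  apply/forall_inP => x; rewrite inE => gx; apply/forallP => s.
  by rewrite !inE !gM (negbTE gx) andbF.
have gK x : x \in (kernel S : {set S}) -> g x = false.
  by move=> /(subsetP (kernel_sub (SgIdeal idI))); rewrite inE => /negbTE.
pose phi (u : rees (kernel S)) : K := if u is Some x then (g (val x))%:R else 0.
have phiE x : phi (rees_pi _ x) = (g x)%:R.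
  rewrite /phi /rees_pi; case: insubP => [u _ -> //|].
  by rewrite negbK => /gK ->.
suff gF s : g s = false by move=> s t; rewrite !gF.
apply/negP => gs.
suff /u1/(_ None)/eqP : sgcharacter phi by rewrite /= eq_sym oner_eq0.
split=> [u v|]; last by exists (rees_pi _ s); rewrite phiE gs oner_neq0.
have [x <-] := rees_pi_surj u; have [y <-] := rees_pi_surj v.
by rewrite -rees_piM !phiE gM -natrM mulnb.
Qed.

Theorem theorem3p2 (R : realType) (S : finSemigroupType) :
  s_indecomposable S <->
  (let A := sgalg (complex R) (rees (kernel S)) in
   exists! I : {vspace quotalg (jacobson A)}, is_algideal I /\ \dim I = 1%N).
Proof.
rewrite /= unique_line_sgcharacter; exact: s_indecomposable_sgcharacter.
Qed.
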